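(* Let $\mathcal{A}\in\mathbb{C}^{m\times p\times n}$, let $k\le\min(m,p)$ and $q\le\min(n,p)$ be positive integers, and let $M\in\mathbb{C}^{n\times n}$ and $B\in\mathbb{C}^{k\times k}$ be non-zero multiples of unitary matrices. Let $\mathcal{A}=\mathcal{U}\star_M\mathcal{S}\star_M\mathcal{V}^{\rm H}$ be the t-SVDM of $\mathcal{A}$ under $\star_M$, $\mathcal{U}_k=\mathcal{U}_{:,1:k,:}$, and $\mathcal{C}=\mathcal{U}_k^{\rm H}\star_M\mathcal{A}\in\mathbb{C}^{k\times p\times n}$. Let $\mathcal{C}^{\rm P}=\mathcal{W}\star_B\mathcal{D}\star_B\mathcal{Q}^{\rm H}$ be the t-SVDM of the $n\times p\times k$ tensor $\mathcal{C}^{\rm P}$ under $\star_B$, $\mathcal{W}_q=\mathcal{W}_{:,1:q,:}$, $\mathcal{G}=\mathcal{W}_q^{\rm H}\star_B\mathcal{C}^{\rm P}$, and $$\mathcal{A}_{k,q}:=\mathcal{U}_k\star_M(\mathcal{W}_q\star_B\mathcal{G})^{\rm P}=\mathcal{U}_k\star_M\Bigl(\mathcal{W}_q\star_B\mathcal{W}_q^{\rm H}\star_B(\mathcal{U}_k^{\rm H}\star_M\mathcal{A})^{\rm P}\Bigr)^{\rm P}.$$ Then $\mathcal{A}_{k,q}$ is the best approximation to $\mathcal{A}$ (a minimizer of the Frobenius norm of the difference) among all tensors that can be expressed in the form $$\sum_{i=1}^{k}\mathcal{U}_{:,i,:}\star_M\Bigl[\Bigl(\sum_{j=1}^{q}\mathcal{X}_{:,j,:}\star_B\mathcal{H}_{j,:,:}\Bigr)^{\rm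 P}\Bigr]_{i,:,:},$$ where the lateral slices $\mathcal{U}_{:,i,:}$ are those of the t-SVDM of $\mathcal{A}$ and $\mathcal{X},\mathcal{H}$ are any $n\times q\times k$ and $q\times p\times k$ tensors, respectively.
   Context: MATLAB index notation is used. For a tensor $\mathcal{A}\in\mathbb{C}^{m\times p\times n}$, $\mathcal{A}^{\rm P}\in\mathbb{C}^{n\times p\times m}$ is the permuted tensor $(\mathcal{A}^{\rm P})_{k,j,i}=\mathcal{A}_{i,j,k}$. For an invertible $n\times n$ matrix $M$ and tensor with third dimension $n$, $\widehat{\mathcal{A}}=\mathcal{A}\times_3M$ is given by $\widehat{\mathcal{A}}_{i,j,k}=\sum_lM_{kl}\mathcal{A}_{i,j,l}$. The product $\mathcal{C}=\mathcal{A}\star_M\mathcal{B}$ is defined by $\widehat{\mathcal{C}}_{:,:,i}=\widehat{\mathcal{A}}_{:,:,i}\widehat{\mathcal{B}}_{:,:,i}$ for all $i$, and $\mathcal{C}=\widehat{\mathcal{C}}\times_3M^{-1}$; the conjugate transpose under $\star_M$ by $(\widehat{\mathcal{A}^{\rm H}})_{:,:,i}=(\widehat{\mathcal{A}}_{:,:,i})^{\rm H}$. $\star_B$ is the same construction with the $k\times k$ matrix $B$ applied to tensors with third dimension $k$ (conjugate transposes of $\mathcal{W},\mathcal{Q}$ are under $\star_B$). The t-SVDM of $\mathcal{A}$ under $\star_M$ is $\mathcal{A}=\mathcal{U}\star_M\mathcal{S}\star_M\mathcal{V}^{\rm H}$, where for each $i$, $\widehat{\mathcal{A}}_{:,:,i}=\widehat{\mathcal{U}}_{:,:,i}\widehat{\mathcal{S}}_{:,:,i}\widehat{\mathcal{V}}_{:,:,i}^{\rm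 H}$ is a matrix SVD with singular values in non-increasing order on the diagonal, and $\mathcal{U},\mathcal{S},\mathcal{V}$ are obtained by applying $\times_3M^{-1}$; similarly under $\star_B$. *)

(* Defs.v *)
From HB Require Import structures.
From mathcomp Require Import all_boot all_order all_algebra spectral.
From mathcomp Require Export complex reals.

Set Implicit Arguments.
Unset Strict Implicit.
Unset Printing Implicit Defensive.

Import Order.TTheory GRing.Theory Num.Theory.
Local Open Scope ring_scope.
Local Open Scope sesquilinear_scope.

(* An m x p x n tensor is the family of its frontal slices: [A k] is the m x p
   matrix A_{:,:,k}, so the entry A_{i,j,k} is [A k i j]. *)
Notation tensor K m p n := {ffun 'I_n -> 'M[K]_(m, p)}.

Section Tensors.
Variable K : numClosedFieldType.
Implicit Types m p n r : nat.

Definition tpermute m p n (A : tensor K m p n) : tensor K n p m :=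
  [ffun i => \matrix_(k, j) A k i j].

Definition mode3 m p n (M : 'M[K]_n) (A : tensor K m p n) : tensor K m p n :=
  [ffun k => \sum_l M k l *: A l].

Definition tprod m r p n (M : 'M[K]_n)
    (A : tensor K m r n) (B : tensor K r p n) : tensor K m p n :=
  mode3 (invmx M) [ffun i => mode3 M A i *m mode3 M B i].

Definition tctr m p n (M : 'M[K]_n) (A : tensor K m p n) : tensor K p m n :=
  mode3 (invmx M) [ffun i => (mode3 M A i) ^t*].

(* The order of K is partial, with [0 <= z] meaning that z is a nonnegative
   real. *)
Definition is_svd m p (A : 'M[K]_(m, p))
    (U : 'M[K]_m) (S : 'M[K]_(m, p)) (V : 'M[K]_p) : Prop :=
  [/\ U \is unitarymx,
      V \is unitarymx,
      (forall (i : 'I_m) (j : 'I_p), (i : nat) <> j -> S i j = 0),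
      (forall (i : 'I_m) (j : 'I_p), (i : nat) = j -> 0 <= S i j)
      /\ (forall (i i' : 'I_m) (j j' : 'I_p),
            (i : nat) = j -> (i' : nat) = j' -> (i <= i')%N -> S i' j' <= S i j)
    & A = U *m S *m V ^t*].

Definition is_tsvdm m p n (M : 'M[K]_n) (A : tensor K m p n)
    (U : tensor K m m n) (S : tensor K m p n) (V : tensor K p p n) : Prop :=
  A = tprod M (tprod M U S) (tctr M V) /\
  (forall i, is_svd (mode3 M A i) (mode3 M U i) (mode3 M S i) (mode3 M V i)).

Definition nonzero_multiple_of_unitary n (M : 'M[K]_n) : Prop :=
  exists (c : K) (Z : 'M[K]_n), [/\ c != 0, Z \is unitarymx & M = c *: Z].

(* A_{:,1:r',:} *)
Definition first_laterals m r r' n (h : (r' <= r)%N) (A : tensor K m r n) :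
    tensor K m r' n :=
  [ffun k => colsub (widen_ord h) (A k)].

(* A_{:,j,:} *)
Definition lateral m p n (j : 'I_p) (A : tensor K m p n) : tensor K m 1 n :=
  [ffun k => col j (A k)].

(* A_{i,:,:} *)
Definition horizontal m p n (i : 'I_m) (A : tensor K m p n) : tensor K 1 p n :=
  [ffun k => row i (A k)].

Definition frobenius m p n (A : tensor K m p n) : K :=
  sqrtC (\sum_k \sum_i \sum_j `|A k i j| ^+ 2).

(* The tensors among which the approximation is sought; only the first k
   lateral slices of U enter. *)
Definition two_sided_form m p n k q (hkm : (k <= m)%N)
    (M : 'M[K]_n) (B : 'M[K]_k) (U : tensor K m m n)
    (X : tensor K n q k) (H : tensor K q p k) : tensor K m p n :=
  \sum_(i < k)
    tprod M (lateral (widen_ord hkm i) U)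
      (horizontal i
        (tpermute (\sum_(j < q) tprod B (lateral j X) (horizontal j H)))).

End Tensors.

(* Main.v *)
From HB Require Import structures.
Require Import Defs.
From mathcomp Require Import all_boot all_order all_algebra spectral.

Set Implicit Arguments.
Unset Strict Implicit.
Unset Printing Implicit Defensive.

Import Order.TTheory GRing.Theory Num.Theory.
Local Open Scope ring_scope.

(** The map [mode3 M] multiplies the squared Frobenius norm by a constant when
    [M] is a nonzero multiple of a unitary matrix, and it turns the product of
    tensors into slicewise matrix products.  Hence every statement below about
    squared norms of tensors is a sum over frontal slices of a statement about
    matrices.

    The slices of [Uk] have orthonormal columns.  A tensor of the two-sided form
    is [Uk] times [Y], with [Y] the permutation of the product of [X] and [H]
    ([two_sided_formE]), and Pythagoras ([tensor_pythagoras]) gives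
      |A - Uk Y|^2 = |A - Uk (Uk^H A)|^2 + |C - Y|^2,   C = Uk^H A.
    The first term does not depend on [X] and [H].  Permuting the modes keeps the
    norm, so the second term is the squared distance from the permutation of [C]
    to the product of [X] and [H], whose transformed slices are arbitrary matrices
    that factor through dimension [q].  By the theorem of Eckart and Young applied
    to each slice ([eckart_young], [tensor_eckart_young]) that distance is least
    for the product of [Wq] with [G], which is the choice made in [Akq].

    For the theorem of Eckart and Young itself, let N = W D Q^H be a singular
    value decomposition.  The competitor N - X H is bounded below by
    compressing it with a matrix [V] that has orthonormal rows, at least
    n - q of them, and kills W^H X: what remains of W^H (N - X H) is V D Q^H.
    Its squared norm is a weighted sum of the squared singular values with
    weights in [0, 1] of total mass at least n - q, and such a sum is least when
    the weights sit on the smallest values ([truncated_weighted_sum]). *)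

(** * Squared Frobenius norm and isometries *)

Section MatrixNorm.
Local Open Scope sesquilinear_scope.
Variable K : numClosedFieldType.
Implicit Types m n p q r : nat.

Lemma ctr_mul m n p (X : 'M[K]_(m, n)) (Y : 'M[K]_(n, p)) :
  (X *m Y)^t* = Y^t* *m X^t*.
Proof. by rewrite trmx_mul map_mxM. Qed.

Lemma ctrD m n (X Y : 'M[K]_(m, n)) : (X + Y)^t* = X^t* + Y^t*.
Proof. by rewrite linearD map_mxD. Qed.

Definition sqnorm m n (X : 'M[K]_(m, n)) : K := \sum_i \sum_j `|X i j| ^+ 2.

Lemma sqnorm_ge0 m n (X : 'M[K]_(m, n)) : 0 <= sqnorm X.
Proof.
by apply: sumr_ge0 => i _; apply: sumr_ge0 => j _; rewrite exprn_ge0.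
Qed.

Lemma sqnorm_mxtrace m n (X : 'M[K]_(m, n)) : sqnorm X = \tr (X^t* *m X).
Proof.
rewrite /sqnorm exchange_big; apply: eq_bigr => j _; rewrite mxE.
by apply: eq_bigr => i _; rewrite !mxE normCKC.
Qed.

Lemma sqnorm_ctr m n (X : 'M[K]_(m, n)) : sqnorm (X^t*) = sqnorm X.
Proof. by rewrite !sqnorm_mxtrace trmxCK mxtrace_mulC. Qed.

Lemma sqnorm_scale_isometry m n p (c : K) (P : 'M[K]_(m, n)) (Y : 'M[K]_(n, p)) :
  P^t* *m P = 1%:M -> sqnorm (c *: (P *m Y)) = `|c| ^+ 2 * sqnorm Y.
Proof.
move=> PP; rewrite !sqnorm_mxtrace [trmx _]linearZ /= map_mxZ.
rewrite -scalemxAl -scalemxAr scalerA.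
by rewrite ctr_mul mulmxA -(mulmxA _ _ P) PP mulmx1 mxtraceZ normCKC.
Qed.

Lemma sqnorm_isometry m n p (P : 'M[K]_(m, n)) (Y : 'M[K]_(n, p)) :
  P^t* *m P = 1%:M -> sqnorm (P *m Y) = sqnorm Y.
Proof.
by move=> /(sqnorm_scale_isometry 1 Y); rewrite scale1r normr1 expr1n mul1r.
Qed.

(** [X - P Y] splits into [X - P P^* X], which is orthogonal to the column space of
    [P], and [P (P^* X - Y)], which lies in it; [P] preserves the norm of the
    latter. *)
Lemma pythagoras m n p (X : 'M[K]_(m, n)) (P : 'M[K]_(m, p)) (Y : 'M[K]_(p, n)) :
  P^t* *m P = 1%:M ->
  sqnorm (X - P *m Y)
    = sqnorm (X - P *m (P^t* *m X)) + sqnorm (P^t* *m X - Y).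
Proof.
move=> PP; set E := X - P *m (P^t* *m X); set F := P^t* *m X - Y.
have -> : X - P *m Y = E + P *m F by rewrite mulmxBr addrA subrK.
have PE : P^t* *m E = 0 by rewrite mulmxBr (mulmxA _ P) PP mul1mx subrr.
have EP : E^t* *m P = 0 by rewrite -[P]trmxCK -ctr_mul PE trmx0 map_mx0.
clearbody E F; rewrite -(sqnorm_isometry F PP) !sqnorm_mxtrace ctrD mulmxDl.
rewrite !mulmxDr.
rewrite (mulmxA (E^t*)) EP mul0mx addr0 ctr_mul -(mulmxA _ _ E) PE mulmx0 add0r.
by rewrite mxtraceD.
Qed.

(** Pythagoras for the isometry [V^*] and [Y = 0]: [|V Y|^2] is the part of
    [|Y|^2] carried by the row space of [V]. *)
Lemma coisometry_contraction m n p (V : 'M[K]_(m, n)) (Y : 'M[K]_(n, p)) :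
  V \is unitarymx -> sqnorm (V *m Y) <= sqnorm Y.
Proof.
move=> /unitarymxP VV; have := @pythagoras _ _ _ Y (V^t*) 0.
rewrite trmxCK mulmx0 !subr0 => -> //.
by rewrite lerDr sqnorm_ge0.
Qed.

(** * The Eckart-Young theorem in Frobenius norm *)

(** Moving the weights to the last indices can only decrease the sum: the
    difference is the sum of [d i * (w i - 1_{q <= i})], in which [d i] may be
    replaced by a threshold separating the first [q] values from the others,
    since the second factor is nonnegative before [q] and nonpositive from [q]
    on.  With a constant in place of [d i] the sum is that constant times
    [r - (n - q)]. *)
Lemma truncated_weighted_sum n q r (d w : 'I_n -> K) :
    (q <= n)%N -> (n - q <= r)%N ->
    (forall i, 0 <= d i) -> (forall i j : 'I_n, (i <= j)%N -> d j <= d i) ->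
    (forall i, 0 <= w i) -> (forall i, w i <= 1) -> \sum_i w i = r%:R ->
  \sum_(i < n | (q <= i)%N) d i <= \sum_(i < n) d i * w i.
Proof.
move=> qn nqr d0 dle w0 w1 wr.
have [s [s0 sup sdn]] : exists s, [/\ 0 <= s,
    forall i : 'I_n, (i < q)%N -> s <= d i
    & forall i : 'I_n, (q <= i)%N -> d i <= s].
  case: (ltnP q n) => [ltqn|nq].
    exists (d (Ordinal ltqn)); split=> // i qi; apply: dle => //=; exact: ltnW.
  exists 0; split=> // i qi.
  by have := leq_ltn_trans (leq_trans nq qi) (ltn_ord i); rewrite ltnn.
rewrite -subr_ge0.
have -> : \sum_(i < n) d i * w i - \sum_(i < n | (q <= i)%N) d i
   = \sum_(i < n) d i * (w i - (q <= i)%N%:R).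
  under [RHS]eq_bigr do rewrite mulrBr.
  rewrite sumrB; congr (_ - _); rewrite big_mkcond; apply: eq_bigr => i _.
  by case: leqP; rewrite ?mulr1 ?mulr0.
have card_ge : \sum_(i < n) ((q <= i)%N%:R : K) = (n - q)%:R.
  rewrite -natr_sum -(big_mkord xpredT (fun i => (q <= i)%N : nat)).
  rewrite (big_cat_nat (n := q)) //= big_nat_cond big1 ?add0n.
    rewrite big_nat_cond (eq_bigr (fun _ => 1%N)).
      by rewrite -big_nat_cond sum_nat_const_nat muln1.
    by move=> i /andP[/andP[-> _] _].
  by move=> i /andP[/andP[_ iq] _]; rewrite leqNgt iq.
apply: (@le_trans _ _ (\sum_(i < n) s * (w i - (q <= i)%N%:R))).
  by rewrite -mulr_sumr sumrB wr card_ge mulr_ge0 // subr_ge0 ler_nat.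
apply: ler_sum => i _; case: leqP => qi.
  by rewrite ler_wnM2r ?subr_le0 ?sdn.
by rewrite ler_wpM2r ?subr_ge0 ?sup.
Qed.

Definition row_sqnorm m n (X : 'M[K]_(m, n)) (i : 'I_m) : K :=
  \sum_j `|X i j| ^+ 2.

Lemma row_sqnorm_mulmx_ctr m n (X : 'M[K]_(m, n)) i :
  row_sqnorm X i = (X *m X^t*) i i.
Proof. by rewrite mxE; apply: eq_bigr => j _; rewrite !mxE normCK. Qed.

(** An orthonormal basis of the left kernel of [X], whose dimension is
    [n - \rank X]. *)
Lemma left_annihilator n q (X : 'M[K]_(n, q)) :
  exists r (V : 'M[K]_(r, n)), [/\ V \is unitarymx, V *m X = 0 & (n - q <= r)%N].
Proof.
exists (\rank (kermx X)), (schmidt (row_base (kermx X))); split.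
- by rewrite schmidt_unitarymx ?rank_leq_row.
- apply/sub_kermxP.
  by rewrite (eqmx_schmidt_free (row_base_free _)) eq_row_base.
- by rewrite mxrank_ker leq_sub2l ?rank_leq_col.
Qed.

Definition rect_diag m p (D : 'M[K]_(m, p)) : Prop :=
  forall (i : 'I_m) (j : 'I_p), (i : nat) <> j -> D i j = 0.

Lemma rect_diag_gram m p (D : 'M[K]_(m, p)) :
  rect_diag D -> D *m D^t* = diag_mx (\row_i row_sqnorm D i).
Proof.
move=> Dd; apply/matrixP => i j; rewrite !mxE.
have [->|ij] := eqVneq i j.
  by rewrite mulr1n; apply: eq_bigr => a _; rewrite !mxE normCK.
rewrite mulr0n big1 // => a _; rewrite !mxE.
have [ia|/eqP ia] := eqVneq (i : nat) a; last by rewrite (Dd _ _ ia) mul0r.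
have -> : D j a = 0 by apply: Dd; rewrite -ia => /val_inj ji; rewrite ji eqxx in ij.
by rewrite conjC0 mulr0.
Qed.

(** The rows of [D] beyond the [p]-th vanish; the others have the squared
    singular values as squared norms. *)
Lemma rect_diag_row_sqnorm_nincr m p (D : 'M[K]_(m, p)) :
    rect_diag D ->
    (forall (i : 'I_m) (j : 'I_p), (i : nat) = j -> 0 <= D i j) ->
    (forall (i i' : 'I_m) (j j' : 'I_p),
      (i : nat) = j -> (i' : nat) = j' -> (i <= i')%N -> D i' j' <= D i j) ->
  forall i i' : 'I_m, (i <= i')%N -> row_sqnorm D i' <= row_sqnorm D i.
Proof.
move=> Dd D0 Dle i i' ii'; rewrite /row_sqnorm.
have ge0 j : 0 <= `|D i j| ^+ 2 by rewrite exprn_ge0.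
case: (ltnP i' p) => [i'p|pi']; last first.
  rewrite big1 ?sumr_ge0 // => j _; rewrite Dd ?normr0 ?expr0n //.
  by move=> E; have := ltn_ord j; rewrite -E ltnNge pi'.
rewrite (bigD1 (Ordinal i'p)) //= big1 ?addr0 => [|j /eqP ji']; last first.
  by rewrite Dd ?normr0 ?expr0n // => E; apply: ji'; apply: val_inj.
have ip := leq_ltn_trans ii' i'p.
rewrite (bigD1 (Ordinal ip)) //= -[X in X <= _]addr0 lerD ?sumr_ge0 //.
have D0' : 0 <= D i' (Ordinal i'p) by apply: D0.
have DD : D i' (Ordinal i'p) <= D i (Ordinal ip) by apply: Dle.
by rewrite lerXn2r ?nnegrE // !ger0_norm // (le_trans D0').
Qed.

(** [|V D|^2] is the trace of [V^* V (D D^* )], hence the sum of the squared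
    singular values weighted by the squared norms of the columns of [V].  These
    weights are at most 1 because [V] is a contraction, and they add up to
    [\tr (V V^* ) = r]. *)
Lemma coisometry_rect_diag_ge n p q r (V : 'M[K]_(r, n)) (D : 'M[K]_(n, p)) :
    (q <= n)%N -> (n - q <= r)%N -> V \is unitarymx ->
    rect_diag D ->
    (forall i i' : 'I_n, (i <= i')%N -> row_sqnorm D i' <= row_sqnorm D i) ->
  \sum_(i < n | (q <= i)%N) row_sqnorm D i <= sqnorm (V *m D).
Proof.
move=> qn nqr VU Dd Dle; have VV := unitarymxP VU.
pose w i := row_sqnorm (V^t*) i.
have wE i : w i = sqnorm (V *m delta_mx i (0 : 'I_1)).
  rewrite -colE /sqnorm; apply: eq_bigr => a _.
  by rewrite big_ord1 !mxE norm_conjC.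
have -> : sqnorm (V *m D) = \sum_i row_sqnorm D i * w i.
  rewrite -sqnorm_ctr sqnorm_mxtrace trmxCK ctr_mul mulmxA -(mulmxA V).
  rewrite rect_diag_gram // mxtrace_mulC mulmxA.
  rewrite /mxtrace; apply: eq_bigr => i _.
  by rewrite mul_mx_diag /w (row_sqnorm_mulmx_ctr (V^t*)) trmxCK !mxE mulrC.
apply: (truncated_weighted_sum (r := r)) => //.
- by move=> i; apply: sumr_ge0 => j _; rewrite exprn_ge0.
- by move=> i; apply: sumr_ge0 => j _; rewrite exprn_ge0.
- move=> i; rewrite wE; apply: le_trans (coisometry_contraction _ VU) _.
  rewrite sqnorm_mxtrace.
  rewrite trmx_delta map_delta_mx mul_delta_mx.
  by rewrite /mxtrace big_ord1 mxE eqxx.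
- transitivity (\tr (V *m V^t*)); last by rewrite VV mxtrace1.
  rewrite mxtrace_mulC /mxtrace; apply: eq_bigr => i _.
  by rewrite /w row_sqnorm_mulmx_ctr trmxCK.
Qed.

Lemma widen_ord_injective n q (h : (q <= n)%N) : injective (widen_ord h).
Proof. by move=> i j /(congr1 val) ij; apply: val_inj. Qed.

Lemma colsub_ctr m n p (f : 'I_p -> 'I_n) (W : 'M[K]_(m, n)) :
  (colsub f W)^t* = rowsub f (W^t*).
Proof. by apply/matrixP => i j; rewrite !mxE. Qed.

Lemma colsub_isometry m n p (f : 'I_p -> 'I_n) (W : 'M[K]_(m, n)) :
    injective f -> W^t* *m W = 1%:M ->
  (colsub f W)^t* *m colsub f W = 1%:M.
Proof.
move=> finj WW; rewrite colsub_ctr -mxsub_mul WW.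
by apply/matrixP => i j; rewrite !mxE (inj_eq finj).
Qed.

(** Both sides are compared with the sum of the squared singular values from
    index [q] on: the left one equals it by Pythagoras, and the right one is at
    least that by [coisometry_rect_diag_ge], since multiplying by the unitary [W^*]
    and then by an annihilator of [W^* X] does not increase the norm. *)
Lemma eckart_young n p q (hqn : (q <= n)%N) (N : 'M[K]_(n, p))
    (W : 'M[K]_n) (D : 'M[K]_(n, p)) (Q : 'M[K]_p)
    (X : 'M[K]_(n, q)) (H : 'M[K]_(q, p)) :
    is_svd N W D Q ->
  sqnorm (N - colsub (widen_ord hqn) W *m ((colsub (widen_ord hqn) W)^t* *m N))
    <= sqnorm (N - X *m H).
Proof.
case=> WU QU Dd [D0 Dle] NE; set Wq := colsub _ W.
have WW : W^t* *m W = 1%:M by apply/mulmx1C/unitarymxP.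
have normQ r (Y : 'M[K]_(r, p)) : sqnorm (Y *m Q^t*) = sqnorm Y.
  rewrite -sqnorm_ctr ctr_mul trmxCK sqnorm_isometry ?sqnorm_ctr //.
  exact/mulmx1C/unitarymxP.
have WqWq : Wq^t* *m Wq = 1%:M.
  by rewrite /Wq colsub_isometry //; apply: widen_ord_injective.
have normN : sqnorm N = \sum_i row_sqnorm D i.
  by rewrite NE -mulmxA sqnorm_isometry // normQ.
have normWqN : sqnorm (Wq^t* *m N) = \sum_(i < n | (i < q)%N) row_sqnorm D i.
  have -> : Wq^t* *m N = rowsub (widen_ord hqn) D *m Q^t*.
    by rewrite /Wq colsub_ctr !mul_rowsub_mx NE -(mulmxA W) (mulmxA _ W) WW mul1mx.
  rewrite normQ big_ord_narrow; apply: eq_bigr => i _.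
  by apply: eq_bigr => j _; rewrite mxE.
have -> : sqnorm (N - Wq *m (Wq^t* *m N))
    = \sum_(i < n | (q <= i)%N) row_sqnorm D i.
  have := @pythagoras _ _ _ N Wq 0 WqWq; rewrite mulmx0 !subr0 normN normWqN.
  rewrite (bigID (fun i : 'I_n => (i < q)%N)) /= addrC => /addIr <-.
  by apply: eq_bigl => i; rewrite -leqNgt.
have [r [V [VU VX nqr]]] := left_annihilator (W^t* *m X).
apply: le_trans (coisometry_rect_diag_ge hqn nqr VU Dd _) _.
  exact: rect_diag_row_sqnorm_nincr.
have -> : sqnorm (V *m D) = sqnorm (V *m (W^t* *m (N - X *m H))).
  rewrite !mulmxBr (mulmxA _ X) (mulmxA V _ H) VX mul0mx subr0.
  by rewrite NE -(mulmxA W) (mulmxA _ W) WW mul1mx mulmxA normQ.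
apply: le_trans (coisometry_contraction _ VU) _.
by rewrite coisometry_contraction ?trmxC_unitary.
Qed.

End MatrixNorm.

(** * Tensor products in the transformed domain *)

Section TensorNorm.
Local Open Scope sesquilinear_scope.
Variable K : numClosedFieldType.
Implicit Types m n p q r : nat.

Lemma mode3_is_additive m p n (M : 'M[K]_n) (A B : tensor K m p n) :
  mode3 M (A - B) = mode3 M A - mode3 M B.
Proof.
apply/ffunP => k; rewrite !ffunE -sumrB; apply: eq_bigr => l _.
by rewrite !ffunE scalerBr.
Qed.

HB.instance Definition _ m p n (M : 'M[K]_n) :=
  GRing.isZmodMorphism.Build (tensor K m p n) (tensor K m p n) (mode3 M)
    (@mode3_is_additive m p n M).

Lemma mode3B m p n (M : 'M[K]_n) (A B : tensor K m p n) i :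
  mode3 M (A - B) i = mode3 M A i - mode3 M B i.
Proof. by rewrite raddfB !ffunE. Qed.

Lemma mode3_comp m p n (M N : 'M[K]_n) (A : tensor K m p n) :
  mode3 M (mode3 N A) = mode3 (M *m N) A.
Proof.
apply/ffunP => k; rewrite !ffunE.
under eq_bigr do rewrite ffunE scaler_sumr.
rewrite exchange_big; apply: eq_bigr => l _; rewrite mxE scaler_suml.
by apply: eq_bigr => j _; rewrite scalerA.
Qed.

Lemma mode3_id m p n (A : tensor K m p n) : mode3 1%:M A = A.
Proof.
apply/ffunP => k; rewrite ffunE (bigD1 k) //= mxE eqxx scale1r.
by rewrite big1 ?addr0 // => l lk; rewrite mxE eq_sym (negPf lk) scale0r.
Qed.

Lemma mode3K m p n (M : 'M[K]_n) :
  M \in unitmx -> cancel (@mode3 K m p n M) (mode3 (invmx M)).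
Proof. by move=> Mu A; rewrite mode3_comp mulVmx // mode3_id. Qed.

Lemma mode3_tprod m r p n (M : 'M[K]_n) (A : tensor K m r n)
    (B : tensor K r p n) k :
  M \in unitmx -> mode3 M (tprod M A B) k = mode3 M A k *m mode3 M B k.
Proof. by move=> Mu; rewrite mode3_comp mulmxV // mode3_id ffunE. Qed.

Lemma mode3_tctr m p n (M : 'M[K]_n) (A : tensor K m p n) k :
  M \in unitmx -> mode3 M (tctr M A) k = (mode3 M A k)^t*.
Proof. by move=> Mu; rewrite mode3_comp mulmxV // mode3_id ffunE. Qed.

Lemma mode3_colsub m p r n (M : 'M[K]_n) (f : 'I_r -> 'I_p)
    (A : tensor K m p n) k :
  mode3 M [ffun l => colsub f (A l)] k = colsub f (mode3 M A k).
Proof.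
rewrite !ffunE linear_sum; apply: eq_bigr => l _.
by rewrite /= ffunE linearZ.
Qed.

Lemma mode3_rowsub m p r n (M : 'M[K]_n) (f : 'I_r -> 'I_m)
    (A : tensor K m p n) k :
  mode3 M [ffun l => rowsub f (A l)] k = rowsub f (mode3 M A k).
Proof.
rewrite !ffunE linear_sum; apply: eq_bigr => l _.
by rewrite /= ffunE linearZ.
Qed.

Lemma mode3_lateral m p n (M : 'M[K]_n) (A : tensor K m p n) j k :
  mode3 M (lateral j A) k = col j (mode3 M A k).
Proof.
by rewrite colEsub -mode3_colsub.
Qed.

Lemma mode3_horizontal m p n (M : 'M[K]_n) (A : tensor K m p n) i k :
  mode3 M (horizontal i A) k = row i (mode3 M A k).
Proof.
by rewrite rowEsub -mode3_rowsub.
Qed.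

Lemma tprodA m r s p n (M : 'M[K]_n) (A : tensor K m r n)
    (B : tensor K r s n) (C : tensor K s p n) :
  M \in unitmx -> tprod M A (tprod M B C) = tprod M (tprod M A B) C.
Proof.
move=> Mu; apply: (can_inj (mode3K Mu)); apply/ffunP => k.
by rewrite !mode3_tprod // mulmxA.
Qed.

(** In the transformed domain this is the expansion of a matrix product as the sum
    of the outer products of columns with rows. *)
Lemma sum_lateral_horizontal m r p n (M : 'M[K]_n) (A : tensor K m r n)
    (B : tensor K r p n) :
  M \in unitmx ->
  \sum_(j < r) tprod M (lateral j A) (horizontal j B) = tprod M A B.
Proof.
move=> Mu; apply: (can_inj (mode3K Mu)); apply/ffunP => k.
rewrite mode3_tprod // raddf_sum sum_ffunE.
under eq_bigr do rewrite mode3_tprod // mode3_lateral mode3_horizontal.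
apply/matrixP => i j; rewrite summxE [RHS]mxE.
by apply: eq_bigr => l _; rewrite mxE big_ord1 !mxE.
Qed.

Lemma two_sided_formE m p n k q (hkm : (k <= m)%N) (M : 'M[K]_n) (B : 'M[K]_k)
    (U : tensor K m m n) (X : tensor K n q k) (H : tensor K q p k) :
    M \in unitmx -> B \in unitmx ->
  two_sided_form hkm M B U X H
    = tprod M (first_laterals hkm U) (tpermute (tprod B X H)).
Proof.
move=> Mu Bu; rewrite -[RHS]sum_lateral_horizontal // /two_sided_form.
apply: eq_bigr => i _; rewrite sum_lateral_horizontal //.
congr (tprod M _ _); apply/ffunP => l; rewrite !ffunE.
by apply/matrixP => a b; rewrite !mxE.
Qed.

(** * Best approximation of tensors *)

Definition tsqnorm m p n (A : tensor K m p n) : K := \sum_k sqnorm (A k).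

Lemma tsqnorm_ge0 m p n (A : tensor K m p n) : 0 <= tsqnorm A.
Proof. by apply: sumr_ge0 => k _; apply: sqnorm_ge0. Qed.

Lemma frobenius_le m p n (A B : tensor K m p n) :
  (frobenius A <= frobenius B) = (tsqnorm A <= tsqnorm B).
Proof. by rewrite ler_sqrtC // nnegrE; apply: tsqnorm_ge0. Qed.

Lemma tsqnorm_tpermute m p n (A : tensor K m p n) :
  tsqnorm (tpermute A) = tsqnorm A.
Proof.
rewrite /tsqnorm /sqnorm exchange_big; apply: eq_bigr => k _.
by apply: eq_bigr => i _; apply: eq_bigr => j _; rewrite ffunE mxE.
Qed.

Lemma tpermuteK m p n : cancel (@tpermute K m p n) (@tpermute K n p m).
Proof.
by move=> A; apply/ffunP => k; apply/matrixP => i j; rewrite ffunE mxE ffunE mxE.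
Qed.

Lemma tpermuteB m p n (A B : tensor K m p n) :
  tpermute (A - B) = tpermute A - tpermute B.
Proof. by apply/ffunP => i; apply/matrixP => k j; rewrite !(ffunE, mxE). Qed.

(** [mode3] multiplies each fiber of the tensor along the third mode by the
    matrix, so the matrix case applies fiber by fiber. *)
Lemma tsqnorm_mode3 m p n (c : K) (Z : 'M[K]_n) (A : tensor K m p n) :
  Z \is unitarymx -> tsqnorm (mode3 (c *: Z) A) = `|c| ^+ 2 * tsqnorm A.
Proof.
move=> ZU; pose fiber (T : tensor K m p n) i j : 'cV[K]_n := \col_k T k i j.
have fibers (T : tensor K m p n) : tsqnorm T = \sum_i \sum_j sqnorm (fiber T i j).
  rewrite /tsqnorm /sqnorm exchange_big; apply: eq_bigr => i _.
  rewrite exchange_big; apply: eq_bigr => j _; apply: eq_bigr => k _.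
  by rewrite big_ord1 mxE.
have ZZ : Z^t* *m Z = 1%:M by apply/mulmx1C/unitarymxP.
rewrite !fibers mulr_sumr; apply: eq_bigr => i _; rewrite mulr_sumr.
apply: eq_bigr => j _; rewrite -(sqnorm_scale_isometry _ _ ZZ); congr sqnorm.
apply/matrixP => k l; rewrite !mxE ffunE summxE mulr_sumr.
by apply: eq_bigr => h _; rewrite !mxE mulrA.
Qed.

Lemma multiple_of_unitary_unit n (M : 'M[K]_n) :
  nonzero_multiple_of_unitary M -> M \in unitmx.
Proof.
by case=> c [Z [c0 ZU ->]]; rewrite unitmxZ ?unitfE // unitarymx_unit.
Qed.

(** The constant is the same for all sizes of the slices: identities and
    inequalities between squared norms of tensors of different shapes can be
    checked after [mode3 M]. *)
Lemma mode3_tsqnorm n (M : 'M[K]_n) :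
  nonzero_multiple_of_unitary M ->
  exists2 a : K, 0 < a &
    forall m p (A : tensor K m p n), tsqnorm (mode3 M A) = a * tsqnorm A.
Proof.
case=> c [Z [c0 ZU ->]]; exists (`|c| ^+ 2).
  by rewrite exprn_gt0 ?normr_gt0.
by move=> m p A; apply: tsqnorm_mode3.
Qed.

Lemma tensor_pythagoras m k p n (M : 'M[K]_n)
    (A : tensor K m p n) (P : tensor K m k n) (Y : tensor K k p n) :
    nonzero_multiple_of_unitary M ->
    (forall i, (mode3 M P i)^t* *m mode3 M P i = 1%:M) ->
  tsqnorm (A - tprod M P Y)
    = tsqnorm (A - tprod M P (tprod M (tctr M P) A))
      + tsqnorm (tprod M (tctr M P) A - Y).
Proof.
move=> Mc PP; have Mu := multiple_of_unitary_unit Mc.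
have [a a0 aE] := mode3_tsqnorm Mc.
apply: (mulfI (lt0r_neq0 a0)); rewrite mulrDr -!aE /tsqnorm -big_split.
apply: eq_bigr => i _; rewrite !mode3B !mode3_tprod // mode3_tctr //.
exact: pythagoras.
Qed.

Lemma mode3_first_laterals m r r' n (h : (r' <= r)%N) (M : 'M[K]_n)
    (A : tensor K m r n) i :
  mode3 M (first_laterals h A) i = colsub (widen_ord h) (mode3 M A i).
Proof. exact: mode3_colsub. Qed.

Lemma tensor_eckart_young m p n q (hqm : (q <= m)%N) (M : 'M[K]_n)
    (A : tensor K m p n) (U : tensor K m m n) (S : tensor K m p n)
    (V : tensor K p p n) (X : tensor K m q n) (H : tensor K q p n) :
    nonzero_multiple_of_unitary M -> is_tsvdm M A U S V ->
  tsqnorm (A - tprod M (first_laterals hqm U)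
                 (tprod M (tctr M (first_laterals hqm U)) A))
    <= tsqnorm (A - tprod M X H).
Proof.
move=> Mc [_ Asvd]; have Mu := multiple_of_unitary_unit Mc.
have [a a0 aE] := mode3_tsqnorm Mc.
rewrite -(ler_pM2l a0) -!aE; apply: ler_sum => i _.
rewrite !mode3B !mode3_tprod // mode3_tctr // mode3_first_laterals.
exact: eckart_young (Asvd i).
Qed.

End TensorNorm.

Local Open Scope complex_scope.

Theorem theorem8p1 (R : realType) (m p n k q : nat)
    (hk0 : (0 < k)%N) (hkm : (k <= m)%N) (hkp : (k <= p)%N)
    (hq0 : (0 < q)%N) (hqn : (q <= n)%N) (hqp : (q <= p)%N)
    (M : 'M[R[i]]_n) (B : 'M[R[i]]_k)
    (hM : nonzero_multiple_of_unitary M)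
    (hB : nonzero_multiple_of_unitary B)
    (A : tensor R[i] m p n)
    (U : tensor R[i] m m n) (S : tensor R[i] m p n) (V : tensor R[i] p p n)
    (hA : is_tsvdm M A U S V)
    (W : tensor R[i] n n k) (D : tensor R[i] n p k) (Q : tensor R[i] p p k) :
  let Uk : tensor R[i] m k n := first_laterals hkm U in
  let C : tensor R[i] k p n := tprod M (tctr M Uk) A in
  is_tsvdm B (tpermute C) W D Q ->
  let Wq : tensor R[i] n q k := first_laterals hqn W in
  let G : tensor R[i] q p k := tprod B (tctr B Wq) (tpermute C) in
  let Akq : tensor R[i] m p n := tprod M Uk (tpermute (tprod B Wq G)) in
  [/\ Akq = tprod M Uk (tpermute
              (tprod B (tprod B Wq (tctr B Wq))
                 (tpermute (tprod M (tctr M Uk) A)))),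
      (exists (X : tensor R[i] n q k) (H : tensor R[i] q p k),
         Akq = two_sided_form hkm M B U X H)
    & (forall (X : tensor R[i] n q k) (H : tensor R[i] q p k),
         frobenius (A - Akq)
           <= frobenius (A - two_sided_form hkm M B U X H))].
Proof.
move=> Uk C hC Wq G Akq.
have Mu := multiple_of_unitary_unit hM; have Bu := multiple_of_unitary_unit hB.
split=> [||X H].
- by rewrite -tprodA.
- by exists Wq, G; rewrite two_sided_formE.
have UkUk i : ((mode3 M Uk i)^t* *m mode3 M Uk i = 1%:M)%sesqui.
  rewrite mode3_first_laterals colsub_isometry //.
    exact: widen_ord_injective.
  by apply/mulmx1C/unitarymxP; case: (hA.2 i).
(* The summand without T cancels when two choices of T are compared. *)
have split_error T : tsqnorm (A - tprod M Uk (tpermute T))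
    = tsqnorm (A - tprod M Uk C) + tsqnorm (tpermute C - T).
  rewrite [LHS](tensor_pythagoras A _ hM UkUk); congr (_ + _).
  by rewrite -[LHS]tsqnorm_tpermute tpermuteB tpermuteK.
rewrite frobenius_le (two_sided_formE hkm U X H Mu Bu).
rewrite [leLHS]split_error [leRHS]split_error lerD2l.
exact: tensor_eckart_young hC.
Qed.
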